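(* Let $K\subseteq\mathbb{R}^n$ be a nonempty closed convex cone, $c\in\mathbb{R}^n$, $b\in\mathbb{R}^m$, and let $A\in\mathbb{R}^{m\times n}$ have full rank with $m\le n$. Let $\gamma>0$, let $D$ and $x_0$ be as defined in the context, and consider the iteration $$x^{k+1/2}=P_K(z^k),\qquad x^{k+1}=D(2x^{k+1/2}-z^k)+x_0-\gamma Dc,\qquad z^{k+1}=z^k+x^{k+1}-x^{k+1/2},$$ $k=0,1,\dots$, with any starting point $z^0\in\mathbb{R}^n$. Assume (P) is feasible. If $x^{k+1/2}\to x^\infty$ and $x^{k+1}\to x^\infty$ for some $x^\infty\in\mathbb{R}^n$, then $x^\infty$ is primal optimal (i.e., a solution of (P)), even if $z^k$ does not converge.
   Context: A set $K\subseteq\mathbb{R}^n$ is a cone if $K=\lambda K$ for every $\lambda>0$. (P) is the problem: minimize $c^Tx$ subject to $Ax=b$, $x\in K$. It is feasible if $K\cap\{x\mid Ax=b\}\ne\emptyset$, and a solution is a feasible point attaining the infimum of $c^Tx$ over the feasible set. $P_K$ is the Euclidean projection onto $K$, $D=I-A^T(AA^T)^{-1}A$, and $x_0=A^T(AA^T)^{-1}b$. *)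

(* Defs.v *)
From HB Require Import structures.
From mathcomp Require Import all_boot all_order all_algebra.
From mathcomp Require Import all_classical all_reals all_analysis.

Set Implicit Arguments.
Unset Strict Implicit.
Unset Printing Implicit Defensive.

Import Order.TTheory GRing.Theory Num.Theory.
Import numFieldNormedType.Exports.

Local Open Scope classical_set_scope.
Local Open Scope ring_scope.

Section ConicProgram.
Context {R : realType} {m n : nat}.
Implicit Types (K : set 'cV[R]_n) (A : 'M[R]_(m, n)).
Implicit Types (b : 'cV[R]_m) (c x z p : 'cV[R]_n).

(* The library's norm on matrices is the sup norm, hence this definition. *)
Definition euclid_norm x : R := Num.sqrt (\sum_(i < n) x i 0 ^+ 2).

Definition is_cone K : Prop :=
  forall l : R, 0 < l -> K = [set l *: x | x in K].

(* [is_proj K z p] is the graph of the Euclidean projection, p = P_K(z).  When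
   K is nonempty, closed and convex, each z has exactly one such p. *)
Definition is_proj K z p : Prop :=
  K p /\ forall y, K y -> euclid_norm (z - p) <= euclid_norm (z - y).

Definition Dmx A : 'M[R]_n := 1%:M - A^T *m invmx (A *m A^T) *m A.

Definition x0 A b : 'cV[R]_n := A^T *m invmx (A *m A^T) *m b.

Definition objective c x : R := (c^T *m x) 0 0.

Definition feasible_set K A b : set 'cV[R]_n :=
  K `&` [set x | A *m x = b].

Definition primal_feasible K A b : Prop := feasible_set K A b !=set0.

(* The infimum is taken in the extended reals: it may be -oo, in which case
   there is no solution. *)
Definition is_solution K A b c x : Prop :=
  feasible_set K A b x /\
  (objective c x)%:E =
    ereal_inf [set (objective c y)%:E | y in feasible_set K A b].

End ConicProgram.

(* Main.v *)
Require Import Defs.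
From HB Require Import structures.
From mathcomp Require Import all_boot all_order all_algebra.
From mathcomp Require Import all_classical all_reals all_analysis.
From mathcomp Require Import ring lra.

Set Implicit Arguments.
Unset Strict Implicit.
Unset Printing Implicit Defensive.

Import Order.TTheory GRing.Theory Num.Theory.
Import numFieldNormedType.Exports.

Local Open Scope classical_set_scope.
Local Open Scope ring_scope.

(** Here [xh k] is the half-step iterate x^{k+1/2}.  Write [u k = z k - xh k]
    and [e k = x k.+1 - xh k], so that [z k.+1 = z k + e k].
    Both [xh] and [x] tend to [xinf], so [xinf] lies in the closed set [K] and
    satisfies the linear constraint, which every [x k.+1] satisfies.  Only
    optimality is at stake, and the difficulty is that [z k], hence [u k], may
    be unbounded.

    Two facts keep the unbounded part under control.  First, its component in
    the kernel of [A] is bounded: applying the idempotent [Dmx A] to the update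
    gives [Dmx A (z k.+1) = Dmx A (xh k - gamma c)], whence
    [Dmx A (u k.+1) = Dmx A (xh k - xh k.+1 - gamma c)], which tends to
    [- gamma Dmx A c].  Secondly, let [y] be feasible.  As [xh k] is the
    projection of [z k] on a convex set containing [y], the variational
    inequality [is_proj_variational] gives [<u k, y - xh k> <= 0], so
      [<u k, e k> = <u k, x k.+1 - y> + <u k, y - xh k> <= <u k, x k.+1 - y>],
    where [x k.+1 - y] lies in the kernel of [A], so that the right-hand side
    sees only the kernel component of [u k]; it tends to
    [- gamma <c, xinf - y>].

    The two facts combine in the growth of the squared length of [z]:
      [|z k.+1|^2 - |z k|^2 = 2 <u k, e k> + 2 <xh k, e k> + |e k|^2]
    is bounded above by a sequence with limit [- 2 gamma <c, xinf - y>], because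
    [e k] tends to 0 and [xh k] is bounded.  A nonnegative sequence cannot have
    increments eventually below a negative constant ([drift_limit_ge0]), so
    this limit is nonnegative, that is [<c, xinf> <= <c, y>]. *)

Section InnerProduct.
Context {R : realType}.
Implicit Types n : nat.

Definition dot n (u v : 'cV[R]_n) : R := \sum_(i < n) u i 0 * v i 0.

Lemma dotC n (u v : 'cV[R]_n) : dot u v = dot v u.
Proof. by apply: eq_bigr => i _; rewrite mulrC. Qed.

Lemma dotDl n (u v w : 'cV[R]_n) : dot (u + v) w = dot u w + dot v w.
Proof. by rewrite -big_split; apply: eq_bigr => i _; rewrite mxE mulrDl. Qed.

Lemma dotZl n (a : R) (u v : 'cV[R]_n) : dot (a *: u) v = a * dot u v.
Proof. by rewrite /dot mulr_sumr; apply: eq_bigr => i _; rewrite mxE mulrA. Qed.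

Lemma dotNl n (u v : 'cV[R]_n) : dot (- u) v = - dot u v.
Proof. by rewrite -scaleN1r dotZl mulN1r. Qed.

Lemma dotDr n (u v w : 'cV[R]_n) : dot u (v + w) = dot u v + dot u w.
Proof. by rewrite dotC dotDl !(dotC u). Qed.

Lemma dotZr n (a : R) (u v : 'cV[R]_n) : dot u (a *: v) = a * dot u v.
Proof. by rewrite dotC dotZl dotC. Qed.

Lemma dotNr n (u v : 'cV[R]_n) : dot u (- v) = - dot u v.
Proof. by rewrite dotC dotNl dotC. Qed.

Definition dotE := (dotDl, dotDr, dotNl, dotNr, dotZl, dotZr).

Lemma dot0r n (u : 'cV[R]_n) : dot u 0 = 0.
Proof. by rewrite -(scale0r u) dotZr mul0r. Qed.

Lemma dot_ge0 n (u : 'cV[R]_n) : 0 <= dot u u.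
Proof. by apply: sumr_ge0 => i _; rewrite -expr2 sqr_ge0. Qed.

Lemma dot_eq0 n (u : 'cV[R]_n) : dot u u = 0 -> u = 0.
Proof.
move=> /psumr_eq0P u0; apply/matrixP => i j; rewrite ord1 mxE.
have /eqP : u i 0 * u i 0 = 0 by apply: u0 => // k _; rewrite -expr2 sqr_ge0.
by rewrite mulf_eq0 => /orP[] /eqP.
Qed.

Lemma dot_mulmx n (u v : 'cV[R]_n) : (u^T *m v) 0 0 = dot u v.
Proof. by rewrite mxE; apply: eq_bigr => i _; rewrite mxE. Qed.

Lemma dot_adjoint m n (M : 'M[R]_(m, n)) (u : 'cV[R]_n) (v : 'cV[R]_m) :
  dot (M *m u) v = dot u (M^T *m v).
Proof. by rewrite -!dot_mulmx trmx_mul mulmxA. Qed.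

Lemma euclid_normE n (u : 'cV[R]_n) : euclid_norm u = Num.sqrt (dot u u).
Proof. by congr Num.sqrt; apply: eq_bigr => i _; rewrite expr2. Qed.

Lemma dot_cvg n (u v : nat -> 'cV[R]_n) (lu lv : 'cV[R]_n) :
  u k @[k --> \oo] --> lu -> v k @[k --> \oo] --> lv ->
  dot (u k) (v k) @[k --> \oo] --> dot lu lv.
Proof.
have coord (w : nat -> 'cV[R]_n) (l : 'cV[R]_n) i : w k @[k --> \oo] --> l ->
    w k i 0 @[k --> \oo] --> l i 0.
  move=> wl; apply: (@cvg_comp _ _ _ w (fun M : 'cV[R]_n => M i 0) _ _ _ wl).
  exact: coord_continuous.
move=> ulu vlv; apply: cvg_big => [|i _]; last by apply: cvgM; exact: coord.
exact: add_continuous.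
Qed.

(** Affine constraints pass to the limit; each row of the constraint is an inner
    product, which reduces the claim to [dot_cvg]. *)
Lemma mulmx_cvg m n (M : 'M[R]_(m, n)) (w : nat -> 'cV[R]_n) (l : 'cV[R]_n) b :
  w k @[k --> \oo] --> l -> (forall k, M *m w k = b) -> M *m l = b.
Proof.
move=> wl Mw; apply/matrixP => i j; rewrite ord1 {j}.
have rowE (v : 'cV[R]_n) : (M *m v) i 0 = dot (row i M)^T v.
  by rewrite -dot_mulmx trmxK -row_mul [RHS]mxE.
have : dot (row i M)^T (w k) @[k --> \oo] --> dot (row i M)^T l.
  exact: (dot_cvg (cvg_cst _) wl).
rewrite -rowE; under eq_fun do rewrite -rowE Mw.
by move=> /(cvg_unique (@norm_hausdorff R R)); apply; exact: cvg_cst.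
Qed.

(** If [v] kills the Gram matrix then [v A] has zero length, and the rows of [A]
    are independent. *)
Lemma gram_unit m n (A : 'M[R]_(m, n)) : \rank A = m -> A *m A^T \in unitmx.
Proof.
move=> rA; rewrite -row_free_unit; apply: inj_row_free => v vAA.
have freeA : row_free A by rewrite /row_free rA.
apply: (row_free_inj freeA); rewrite mul0mx.
apply: trmx_inj; rewrite trmx0; apply: dot_eq0.
by rewrite -dot_mulmx trmxK trmx_mul mulmxA -(mulmxA v) vAA mul0mx mxE.
Qed.

Section KernelProjection.
Context {m n : nat} (A : 'M[R]_(m, n)).

Lemma Dmx_sym : (Dmx A)^T = Dmx A.
Proof.
by rewrite /Dmx linearB /= trmx1 !trmx_mul trmxK trmx_inv trmx_mul trmxK mulmxA.
Qed.

Lemma Dmx_ker (v : 'cV[R]_n) : A *m v = 0 -> Dmx A *m v = v.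
Proof. by move=> Av; rewrite /Dmx mulmxBl mul1mx -!mulmxA Av !mulmx0 subr0. Qed.

(** Against a vector of the kernel of [A], any vector may be exchanged for its
    kernel component.  This is how inner products with the unbounded [z k] are
    rewritten in terms of convergent sequences. *)
Lemma dot_Dmx_ker (u v : 'cV[R]_n) : A *m v = 0 -> dot (Dmx A *m u) v = dot u v.
Proof. by move=> Av; rewrite dot_adjoint Dmx_sym Dmx_ker. Qed.

Hypothesis rankA : \rank A = m.

Lemma mul_Dmx : A *m Dmx A = 0.
Proof.
by rewrite /Dmx mulmxBr mulmx1 !mulmxA mulmxV ?gram_unit// mul1mx subrr.
Qed.

Lemma mul_x0 b : A *m x0 A b = b.
Proof. by rewrite /x0 !mulmxA mulmxV ?gram_unit// mul1mx. Qed.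

Lemma Dmx_idem (v : 'cV[R]_n) : Dmx A *m (Dmx A *m v) = Dmx A *m v.
Proof. by apply: Dmx_ker; rewrite mulmxA mul_Dmx mul0mx. Qed.

Lemma Dmx_x0 b : Dmx A *m x0 A b = 0.
Proof.
by rewrite /x0 -!mulmxA -[Dmx A]Dmx_sym mulmxA -trmx_mul mul_Dmx trmx0 mul0mx.
Qed.

End KernelProjection.

(** Moving from [p] towards [w] by a step [t] stays in [K] by convexity and
    changes the squared distance to [z] by [- t (2 a - t q)], with
    [a = dot (z - p) (w - p)] and [q = dot (w - p) (w - p)]; for [a > 0] a small
    [t] would bring the point closer to [z] than [p]. *)
Lemma is_proj_variational n (K : set 'cV[R]_n) (z p w : 'cV[R]_n) :
  convex_set K -> is_proj K z p -> K w -> dot (z - p) (w - p) <= 0.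
Proof.
move=> convK [Kp pmin] Kw; rewrite leNgt; apply/negP.
set a := dot _ _; set q := dot (w - p) (w - p) => a_gt0.
have q_ge0 : 0 <= q by exact: dot_ge0.
have aq_gt0 : 0 < a + q by rewrite ltr_wpDr.
(* This step is at most 1, positive even when [q = 0], and below [2 a / q]
   otherwise. *)
set t := a / (a + q).
have t_gt0 : 0 < t by rewrite divr_gt0.
have t_le1 : t <= 1 by rewrite ler_pdivrMr// mul1r lerDl.
have tE : t * (a + q) = a by rewrite mulfVK// gt_eqF.
have Kt : K (t *: w + (1 - t) *: p).
  have := convK w p (Itv01 (ltW t_gt0) t_le1) (mem_set Kw) (mem_set Kp).
  by rewrite inE.
have := pmin _ Kt.
rewrite !euclid_normE ler_sqrt ?dot_ge0//.
have -> : z - (t *: w + (1 - t) *: p) = (z - p) - t *: (w - p).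
  by apply/matrixP => i j; rewrite !mxE; ring.
have -> : dot ((z - p) - t *: (w - p)) ((z - p) - t *: (w - p))
          = dot (z - p) (z - p) - t * (a *+ 2 - t * q).
  rewrite /a /q; move: (z - p) (w - p) => d e.
  by rewrite !dotE (dotC e d); ring.
have -> : a *+ 2 - t * q = a + t * a.
  by clearbody t a q; lra.
by rewrite lerDl oppr_ge0 leNgt mulr_gt0// addr_gt0// mulr_gt0.
Qed.

(** A negative limit would eventually force [a] to decrease by a fixed amount at
    each step, hence to become negative. *)
Lemma drift_limit_ge0 (a r : nat -> R) (l : R) :
  (forall k, 0 <= a k) -> (forall k, a k.+1 <= a k + r k) ->
  r k @[k --> \oo] --> l -> 0 <= l.
Proof.
move=> a_ge0 a_step rl; rewrite leNgt; apply/negP => l_lt0.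
have /(cvgr_lt _ rl) [N _ rN] : l < l / 2 by lra.
have aN j : a (N + j)%N <= a N + j%:R * (l / 2).
  elim: j => [|j IH]; first by rewrite addn0 mul0r addr0.
  rewrite addnS; apply: (le_trans (a_step _)).
  have /= := rN (N + j)%N (leq_addr _ _).
  rewrite -[j.+1%:R]natr1 mulrDl mul1r; lra.
have := archi_boundP (divr_ge0 (a_ge0 N) (_ : 0 <= - (l / 2))).
rewrite ltr_pdivrMr; last lra.
move=> /(_ ltac:(lra)).
have := aN (Num.bound (a N / - (l / 2))).
have := a_ge0 (N + Num.bound (a N / - (l / 2)))%N.
by move=> *; lra.
Qed.

End InnerProduct.

Theorem theorem14 (R : realType) (m n : nat)
    (K : set 'cV[R]_n) (A : 'M[R]_(m, n)) (b : 'cV[R]_m) (c : 'cV[R]_n)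
    (gamma : R) (z xh x : nat -> 'cV[R]_n) (xinf : 'cV[R]_n)
    (K_nonempty : K !=set0)
    (K_closed : closed K)
    (K_convex : convex_set K)
    (K_cone : is_cone K)
    (le_mn : (m <= n)%N)
    (A_full_rank : \rank A = m)
    (gamma_gt0 : 0 < gamma)
    (xhE : forall k, is_proj K (z k) (xh k))
    (xE : forall k, x k.+1 = Dmx A *m (2 *: xh k - z k) + x0 A b
                             - gamma *: (Dmx A *m c))
    (zE : forall k, z k.+1 = z k + x k.+1 - xh k)
    (feasible : primal_feasible K A b)
    (xh_cvg : xh k @[k --> \oo] --> xinf)
    (x_cvg : x k.+1 @[k --> \oo] --> xinf) :
  is_solution K A b c xinf.
Proof.
have Ax k : A *m x k.+1 = b.
  have AD v : A *m (Dmx A *m v) = 0 by rewrite mulmxA mul_Dmx// mul0mx.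
  by rewrite xE mulmxBr mulmxDr -scalemxAr !AD mul_x0// scaler0 subr0 add0r.
have Kxinf : K xinf.
  apply: (closed_cvg K K_closed _ xinf xh_cvg).
  by apply: nearW => k; case: (xhE k).
have Axinf : A *m xinf = b by exact: mulmx_cvg x_cvg Ax.
split; first by split.
apply/eqP; rewrite eq_le; apply/andP; split; last first.
  by apply: ereal_inf_lbound; exists xinf.
apply: le_ereal_inf_tmp => _ [y [Ky /= Ay] <-]; rewrite lee_fin.
rewrite /objective !dot_mulmx.
have Dz k : Dmx A *m z k.+1 = Dmx A *m (xh k - gamma *: c).
  rewrite zE xE !(mulmxDr, mulmxN) -!scalemxAr !Dmx_idem// Dmx_x0//.
  move: (Dmx A *m z k) (Dmx A *m xh k) (Dmx A *m c) => Z X C.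
  by apply/matrixP => i j; rewrite !mxE; ring.
pose e k := x k.+1 - xh k.
(* [r k] bounds the growth of the squared length from [z k.+1] to [z k.+2]: the
   index starts at 1 because [Dz] describes [z k] for positive [k] only. *)
pose r k := 2 * dot (xh k - xh k.+1 - gamma *: c) (x k.+2 - y)
            + 2 * dot (xh k.+1) (e k.+1) + dot (e k.+1) (e k.+1).
have step k : dot (z k.+2) (z k.+2) <= dot (z k.+1) (z k.+1) + r k.
  have kerv : A *m (x k.+2 - y) = 0 by rewrite mulmxBr Ax Ay subrr.
  have uv : dot (z k.+1 - xh k.+1) (x k.+2 - y)
            = dot (xh k - xh k.+1 - gamma *: c) (x k.+2 - y).
    rewrite -(dot_Dmx_ker _ kerv) mulmxBr Dz -mulmxBr dot_Dmx_ker//.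
    by rewrite addrAC.
  have := is_proj_variational K_convex (xhE k.+1) Ky.
  have -> : z k.+2 = z k.+1 + e k.+1 by rewrite zE addrA.
  rewrite /r -uv.
  have : x k.+2 - y = e k.+1 - (y - xh k.+1).
    by rewrite /e opprB addrA subrK.
  move=> ->; move: (e k.+1) => ek.
  rewrite !dotE (dotC ek (z _)); lra.
have shift (w : nat -> 'cV[R]_n) : w k @[k --> \oo] --> xinf ->
  w k.+1 @[k --> \oo] --> xinf.
  by move=> wl; rewrite (cvg_shiftS w).
have e_cvg : e k.+1 @[k --> \oo] --> (0 : 'cV[R]_n).
  by rewrite -(subrr xinf); exact: cvgB (shift _ x_cvg) (shift _ xh_cvg).
have r_cvg : r k @[k --> \oo] --> 2 * dot (xinf - xinf - gamma *: c) (xinf - y)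
       + 2 * dot xinf 0 + dot (0 : 'cV[R]_n) 0.
  apply: cvgD; last exact: dot_cvg.
  apply: cvgD.
    apply: cvgMr; apply: dot_cvg.
      by apply: cvgB (cvg_cst _); apply: cvgB xh_cvg (shift _ xh_cvg).
    exact: cvgB (shift _ x_cvg) (cvg_cst _).
  by apply: cvgMr; exact: dot_cvg (shift _ xh_cvg) e_cvg.
have := drift_limit_ge0 (fun k => dot_ge0 (z k.+1)) step r_cvg.
rewrite !dot0r subrr sub0r !dotE; nra.
Qed.
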